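(* Let $\mathbb{K}$ be a computable field and $\mathcal{A}=(A,\dots)$ an $\omega$-well structured relational structure. The problem Lin-solv$(\mathbb{K},\mathcal{A})$ reduces to the problem Ideal-memb in $\mathbb{K}[\mathcal{A}]$.
   Context: Relational structures are countable sets with finitely many relations, equality definable; embeddings preserve and reflect all relations; $\mathrm{Emb}(\mathcal{A})$ denotes them. $\omega$-well structured: the quasi order on labellings $\ell:B\to\mathbb{N}$ of finite $B\subseteq A$ given by $\ell\rightsquigarrow\ell'$ ($\ell':B'\to\mathbb{N}$) iff some embedding $\iota$ satisfies $\iota(B)\subseteq B'$ and $\ell(b)\le\ell'(\iota(b))$ for $b\in B$, is a well quasi order. $\mathrm{Lin}(A^d)$ is the $\mathbb{K}$-vector space of finite formal sums of $d$-tuples of elements of $A$; embeddings act pointwise on tuples and linearly on vectors. An indexed family $M=(M_t\in\mathrm{Lin}(A^d))_{t\in A^n}$ is equivariant if $\iota(M_t)=M_{\iota(t)}$ for all $\iota\in\mathrm{Emb}(\mathcal{A})$, $t\in A^n$. Lin-solv$(\mathbb{K},\mathcal{A})$: given $b\in\mathrm{Lin}(A^d)$ and an equivariant family $M$ (represented by a finite $B\subseteq A^n$ with $A^n=\{\iota(t):\iota\in\mathrm{Emb}(\mathcal{A}),t\in B\}$ and the vectors $M_t$ for $t\in B$), decide whether $b$ is a linear combination $r_1M_{t_1}+\dots+r_kM_{t_k}$ ($r_i\in\mathbb{K}$, $t_i\in A^n$). Ideal-memb in $\mathbb{K}[\mathcal{A}]$: given a polynomial $f$ and a finite set $\mathcal{B}$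 of polynomials with variables from $A$, decide whether $f=\sum_ih_i\cdot\iota_i(g_i)$ with $g_i\in\mathcal{B}$, $h_i\in\mathbb{K}[\mathcal{A}]$, $\iota_i\in\mathrm{Emb}(\mathcal{A})$ (embeddings act by renaming variables). *)

(* Defs.v *)
From HB Require Import structures.
From mathcomp Require Import all_boot all_order all_algebra.
From mathcomp Require Import finmap monalg.

Set Implicit Arguments.
Unset Strict Implicit.
Unset Printing Implicit Defensive.

Import GRing.Theory.
Local Open Scope ring_scope.

(* Kleene's mu-recursive functions; [recfun n] is the syntax of partial       *)
(* functions nat^n -> nat, and [eval f v y] means that [f] is defined on [v]  *)
(* with value [y].                                                            *)
Inductive recfun : nat -> Type :=
  | RZero n : recfun n
  | RSucc : recfun 1
  | RProj n (i : 'I_n) : recfun n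
  | RComp m n (f : recfun m) (g : 'I_m -> recfun n) : recfun n
  | RPrec n (f : recfun n) (g : recfun n.+2) : recfun n.+1
  | RMu n (f : recfun n.+1) : recfun n.

(* In the primitive recursion clause, the first argument of [v] is the        *)
(* recursion variable, and [c] lists the intermediate values, with            *)
(* c (k+1) = g(k, c k, rest).  Minimization looks for the least y such that   *)
(* f(y, v) = 0, all the earlier values being defined.                         *)
Fixpoint eval n (f : recfun n) {struct f} : n.-tuple nat -> nat -> Prop :=
  match f in recfun n return n.-tuple nat -> nat -> Prop with
  | RZero n => fun _ y => y = 0%N
  | RSucc => fun v y => y = (thead v).+1
  | RProj n i => fun v y => y = tnth v i
  | RComp m n f g => fun v y =>
      exists w : m.-tuple nat,
        (forall i, eval (g i) v (tnth w i)) /\ eval f w y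
  | RPrec n f g => fun v y =>
      let rest : n.-tuple nat := [tuple of behead v] in
      exists c : nat -> nat,
        [/\ eval f rest (c 0%N),
            forall k, (k < thead v)%N ->
              eval g [tuple of k :: c k :: rest] (c k.+1)
          & y = c (thead v)]
  | RMu n f => fun v y =>
      eval f [tuple of y :: v] 0%N /\
      forall k, (k < y)%N -> exists z, eval f [tuple of k :: v] z.+1
  end.

(* Inputs and outputs are coded by [choice.pickle] (finmap shadows the short  *)
(* name).  On the types used below this is an explicit coding: the identity   *)
(* on nat; the code of a pair, of a dependent pair or of a sequence is        *)
(* [CodeSeq.code] of the sequence of the codes of the components; a tuple has *)
(* the code of the underlying sequence.                                       *)
Definition maps_to (p : recfun 1) (T U : countType) (x : T) (y : U) : Prop :=
  eval p [tuple of [:: choice.pickle x]] (choice.pickle y).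

Definition computable (T U : countType) (f : T -> U) : Prop :=
  exists p : recfun 1, forall x : T, maps_to p x (f x).

(* Elements of [K] are named by their codes; the first clause says that the set  *)
(* of codes is decidable.                                                     *)
Definition computable_field (K : countFieldType) : Prop :=
  [/\ computable (fun n : nat => isSome (pickle_inv n : option K)),
      computable (fun p : K * K => p.1 + p.2),
      computable (fun x : K => - x),
      computable (fun p : K * K => p.1 * p.2)
    & computable (fun x : K => x^-1)].

(* Promise problems: only the inputs satisfying [valid] matter.               *)
Record problem := Problem {
  input : countType;
  valid : input -> Prop;
  yes : input -> Prop
}.

(* Computable many-one reductions.                                            *)
Definition reduces (P Q : problem) : Prop :=
  exists p : recfun 1, forall x : input P, valid x ->
    exists y : input Q,
      [/\ maps_to p x y, valid y & yes x <-> yes y].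

Record relstruct := RelStruct {
  carrier :> countType;
  nb_rel : nat;
  arity : 'I_nb_rel -> nat;
  rel_interp : forall r, (arity r).-tuple carrier -> Prop
}.

(* First-order formulas over the relations of [A], without an equality symbol. *)
Inductive formula (A : relstruct) : Type :=
  | FRel (r : 'I_(nb_rel A)) (x : (arity r).-tuple nat)
  | FFalse
  | FImp (phi psi : formula A)
  | FAll (x : nat) (phi : formula A).

Fixpoint sat (A : relstruct) (phi : formula A) (e : nat -> A) : Prop :=
  match phi with
  | FRel r x => rel_interp (map_tuple e x)
  | FFalse => False
  | FImp phi psi => sat phi e -> sat psi e
  | FAll x phi => forall a, sat phi (fun y => if y == x then a else e y)
  end.

Definition equality_definable (A : relstruct) : Prop :=
  exists phi : formula A, forall e : nat -> A, sat phi e <-> e 0%N = e 1%N.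

(* Injectivity follows when equality is definable.                            *)
Definition embedding (A : relstruct) (iota : A -> A) : Prop :=
  forall (r : 'I_(nb_rel A)) (t : (arity r).-tuple A),
    rel_interp t <-> rel_interp (map_tuple iota t).

Definition wqo (T : Type) (le : T -> T -> Prop) : Prop :=
  [/\ forall x, le x x,
      forall x y z, le x y -> le y z -> le x z
    & forall f : nat -> T, exists i j, (i < j)%N /\ le (f i) (f j)].

Definition labelling_le (A : relstruct) (l l' : {fmap A -> nat}) : Prop :=
  exists iota : A -> A, embedding iota /\
    forall b n, l.[? b]%fmap = Some n ->
      exists2 m, l'.[? iota b]%fmap = Some m & (n <= m)%N.

Definition omega_well_structured (A : relstruct) : Prop :=
  wqo (@labelling_le A).

(* [Lin(A^d)] and [K[A]] both are spaces of finitely supported functions.     *)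
Notation Lin K A d := {malg K[d.-tuple A]}.
Notation polyring K A := {malg K[{cmonom A}]}.

Definition malg_map (K : nzRingType) (S T : choiceType) (g : S -> T)
    (v : {malg K[S]}) : {malg K[T]} :=
  \sum_(s <- msupp v) << v@_s *g g s >>.

Definition monom_of (A : choiceType) (s : seq (A * nat)) : {cmonom A} :=
  \big[mmul/mone]_(p <- s) expcmn (ucm p.1) p.2.

Definition rename_monom (A : choiceType) (iota : A -> A) (m : {cmonom A}) :
    {cmonom A} :=
  monom_of [seq (iota a, m a) | a <- finsupp (cmonom_val m)].

Definition lin_act (K : fieldType) (A : relstruct) (d : nat) (iota : A -> A) :
    Lin K A d -> Lin K A d :=
  malg_map (map_tuple iota).

Definition poly_act (K : fieldType) (A : relstruct) (iota : A -> A) :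
    polyring K A -> polyring K A :=
  malg_map (rename_monom iota).

Definition equivariant (K : fieldType) (A : relstruct) (d n : nat)
    (M : n.-tuple A -> Lin K A d) : Prop :=
  forall iota, embedding iota ->
    forall t, lin_act iota (M t) = M (map_tuple iota t).

(* A vector is given as a list of terms (coefficient, tuple), and a           *)
(* polynomial as a list of terms (coefficient, monomial), a monomial being    *)
(* itself a list of powers (variable, exponent).  Lists are not required to   *)
(* be reduced: repeated entries are summed, resp. multiplied.                 *)
Definition vec_of (K : fieldType) (T : choiceType) (s : seq (K * T)) :
    {malg K[T]} :=
  \sum_(p <- s) << p.1 *g p.2 >>.

Definition poly_of (K : fieldType) (A : choiceType)
    (s : seq (K * seq (A * nat))) : polyring K A :=
  \sum_(p <- s) << p.1 *g monom_of p.2 >>.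

(* Inputs of Lin-solv: the dimensions (d, n), the vector b, and the list of   *)
(* the pairs (t, M_t) for t in B.                                             *)
Definition lin_data (K : countFieldType) (A : countType) (dn : nat * nat) :
    countType :=
  (seq (K * dn.1.-tuple A) *
   seq (dn.2.-tuple A * seq (K * dn.1.-tuple A)))%type.

Definition lin_input (K : countFieldType) (A : countType) : countType :=
  {dn : nat * nat & lin_data K A dn}.

Definition represents (K : countFieldType) (A : relstruct) (d n : nat)
    (B : seq (n.-tuple A * seq (K * d.-tuple A)))
    (M : n.-tuple A -> Lin K A d) : Prop :=
  [/\ equivariant M,
      forall p, p \in B -> M p.1 = vec_of p.2
    & forall t : n.-tuple A, exists iota p,
        [/\ embedding iota, p \in B & t = map_tuple iota p.1]].

Definition lin_combination (K : fieldType) (A : relstruct) (d n : nat)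
    (b : Lin K A d) (M : n.-tuple A -> Lin K A d) : Prop :=
  exists (k : nat) (r : 'I_k -> K) (t : 'I_k -> n.-tuple A),
    b = \sum_(i < k) r i *: M (t i).

(* On valid inputs the represented family is unique.                          *)
Definition Lin_solv (K : countFieldType) (A : relstruct) : problem :=
  @Problem (lin_input K A)
    (fun x => exists M, represents (tagged x).2 M)
    (fun x => exists M, represents (tagged x).2 M /\
                        lin_combination (vec_of (tagged x).1) M).

Definition ideal_memb (K : fieldType) (A : relstruct)
    (f : polyring K A) (B : seq (polyring K A)) : Prop :=
  exists (k : nat) (h g : 'I_k -> polyring K A) (iota : 'I_k -> A -> A),
    (forall i, g i \in B /\ embedding (iota i)) /\
    f = \sum_(i < k) h i * poly_act (iota i) (g i).

Definition Ideal_memb (K : countFieldType) (A : relstruct) : problem :=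
  @Problem (seq (K * seq (A * nat)) * seq (seq (K * seq (A * nat))))%type
    (fun=> True)
    (fun x => ideal_memb (poly_of x.1) [seq poly_of g | g <- x.2]).

(* Main.v *)
(* A tuple (a_0, ..., a_(d-1)) is sent to the monomial prod_i a_i^(2^i).      *)
(* This map commutes with renaming of variables; it is injective, because the *)
(* binary digits of the exponent of a variable are its positions in the       *)
(* tuple; and its values all have degree 2^d - 1.  It therefore sends vectors *)
(* to homogeneous polynomials of one degree, injectively and equivariantly.   *)
(* If the image of b equals sum_i h_i * iota_i(g_i), with g_i images of       *)
(* vectors of the family, then comparing the terms of degree 2^d - 1 only the *)
(* constant terms of the h_i matter, so b is a linear combination.            *)
(* The translation copies the codes of field and structure elements, and      *)
(* only has to walk through coded sequences.                                  *)

From HB Require Import structures.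
Require Import Defs.
From mathcomp Require Import all_boot all_order all_algebra.
From mathcomp Require Import finmap monalg.

Set Implicit Arguments.
Unset Strict Implicit.
Unset Printing Implicit Defensive.

Import GRing.Theory.

(** * Recursive functions on coded sequences *)

(** Ideal membership allows arbitrary polynomials as multipliers, linear solvability only scalars;
    the encoding [tuple_monom] removes the difference. Tuples of one length give monomials of one
    degree ([mdeg_powers]), and distinct ones give distinct monomials ([monom_of_powers_inj]).
    Hence, by [mcoeff_mul_homog], reading coefficients at encoded tuples replaces each multiplier by
    its constant term. The encoding commutes with renaming of variables ([poly_act_lin_poly]), so
    the renamed generators are exactly the encodings of the vectors [M t], and
    [lin_combination_ideal_memb] follows. For computability, the translation [ideal_input] is
    mirrored by an arithmetic function [input_code] on codes; it is recursive
    ([recursive_input_code]) and agrees with the translation ([pickle_ideal_input]). Codes of field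
    elements and of variables are treated as opaque numbers. *)

Definition recursive n (F : n.-tuple nat -> nat) : Prop :=
  exists p : recfun n, forall v, eval p v (F v).

Lemma recursive_nth n i : recursive (fun v : n.-tuple nat => nth 0 v i).
Proof.
have [ltin|leni] := ltnP i n; last first.
  by exists (RZero n) => v /=; rewrite nth_default // size_tuple.
by exists (RProj (Ordinal ltin)) => v /=; rewrite (tnth_nth 0).
Qed.

Lemma eq_recursive n (F G : n.-tuple nat -> nat) :
  F =1 G -> recursive F -> recursive G.
Proof. by move=> eqFG [p pP]; exists p => v; rewrite -eqFG. Qed.

Lemma recursive_succ n (F : n.-tuple nat -> nat) :
  recursive F -> recursive (fun v => (F v).+1).
Proof.
case=> p pP; exists (RComp RSucc (fun=> p)) => v.
by exists [tuple F v]; split=> // i; rewrite (ord1 i); apply: pP.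
Qed.

Lemma recursive_const n c : recursive (fun _ : n.-tuple nat => c).
Proof.
elim: c => [|c IHc]; first by exists (RZero n).
exact: recursive_succ IHc.
Qed.

Lemma recursive_comp1 n (f : nat -> nat) (F : n.-tuple nat -> nat) :
  recursive (fun w : 1.-tuple nat => f (nth 0 w 0)) ->
  recursive F -> recursive (fun v => f (F v)).
Proof.
case=> p pP [q qP]; exists (RComp p (fun=> q)) => v.
exists [tuple F v]; split=> [i|]; last exact: pP.
by rewrite (ord1 i); exact: qP.
Qed.

Lemma recursive_comp2 n (f : nat -> nat -> nat) (F G : n.-tuple nat -> nat) :
  recursive (fun w : 2.-tuple nat => f (nth 0 w 0) (nth 0 w 1)) ->
  recursive F -> recursive G -> recursive (fun v => f (F v) (G v)).
Proof.
case=> p pP [q qP] [r rP]; exists (RComp p (tnth [tuple q; r])) => v.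
exists [tuple F v; G v]; split=> [i|]; last exact: pP.
by case: i => [[|[|i]] lti].
Qed.

Lemma recursive_rec (h : nat -> nat -> nat) (f : nat -> nat)
    (g : nat -> nat -> nat -> nat) :
  recursive (fun w : 1.-tuple nat => f (nth 0 w 0)) ->
  recursive (fun w : 3.-tuple nat => g (nth 0 w 0) (nth 0 w 1) (nth 0 w 2)) ->
  (forall x, h 0 x = f x) ->
  (forall k x, h k.+1 x = g k (h k x) x) ->
  recursive (fun w : 2.-tuple nat => h (nth 0 w 0) (nth 0 w 1)).
Proof.
case=> p pP [q qP] h0 hS; exists (RPrec p q) => -[[|k [|x []]] // sz].
exists (fun k => h k x); split=> //= [|j _].
  by rewrite h0; apply: pP.
by rewrite hS; apply: qP.
Qed.

Lemma recursive_rec1 (h : nat -> nat) (g : nat -> nat -> nat) :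
  recursive (fun w : 2.-tuple nat => g (nth 0 w 0) (nth 0 w 1)) ->
  (forall k, h k.+1 = g k (h k)) ->
  recursive (fun w : 1.-tuple nat => h (nth 0 w 0)).
Proof.
move=> g_rec hS.
pose h' k (_ : nat) := h k.
apply: (@recursive_comp2 1 h' _ (fun=> 0)); last exact: recursive_const.
2: exact: recursive_nth.
apply: (@recursive_rec h' (fun=> h 0) (fun k c _ => g k c)) => //.
- exact: recursive_const.
- by apply: recursive_comp2; [exact: g_rec | exact: recursive_nth..].
- by move=> k x; exact: hS.
Qed.

Lemma recursive_pred n (F : n.-tuple nat -> nat) :
  recursive F -> recursive (fun v => (F v).-1).
Proof.
apply: recursive_comp1; apply: (@recursive_rec1 predn (fun k _ => k)) => //.
exact: recursive_nth.
Qed.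

Lemma recursive_add n (F G : n.-tuple nat -> nat) :
  recursive F -> recursive G -> recursive (fun v => F v + G v).
Proof.
apply: recursive_comp2; apply: (@recursive_rec addn id (fun _ c _ => c.+1)) => //.
- exact: recursive_nth.
- exact/recursive_succ/recursive_nth.
Qed.

Lemma recursive_sub n (F G : n.-tuple nat -> nat) :
  recursive F -> recursive G -> recursive (fun v => F v - G v).
Proof.
move=> F_rec G_rec; apply: (@recursive_comp2 n (fun y x => x - y) G F) => //.
apply: (@recursive_rec (fun y x => x - y) id (fun _ c _ => c.-1)) => //.
- exact: recursive_nth.
- exact/recursive_pred/recursive_nth.
- exact: subn0.
- by move=> k x; rewrite subnS.
Qed.

Lemma recursive_mul n (F G : n.-tuple nat -> nat) :
  recursive F -> recursive G -> recursive (fun v => F v * G v).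
Proof.
apply: recursive_comp2.
apply: (@recursive_rec muln (fun=> 0) (fun _ c x => x + c)) => //.
- exact: recursive_const.
- by apply: recursive_add; exact: recursive_nth.
Qed.

Lemma recursive_exp2 n (F : n.-tuple nat -> nat) :
  recursive F -> recursive (fun v => 2 ^ F v).
Proof.
apply: recursive_comp1.
apply: (@recursive_rec1 (fun k => 2 ^ k) (fun _ c => 2 * c)) => [|k].
  by apply: recursive_mul; [exact: recursive_const | exact: recursive_nth].
exact: expnS.
Qed.

Lemma recursive_odd n (F : n.-tuple nat -> nat) :
  recursive F -> recursive (fun v => odd (F v) : nat).
Proof.
apply: (@recursive_comp1 _ (fun k => odd k)).
apply: (@recursive_rec1 (fun k => odd k) (fun _ c => 1 - c)) => [|k].
  by apply: recursive_sub; [exact: recursive_const | exact: recursive_nth].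
by rewrite oddS; case: (odd k).
Qed.

Lemma recursive_half n (F : n.-tuple nat -> nat) :
  recursive F -> recursive (fun v => (F v)./2).
Proof.
apply: recursive_comp1.
(* The lower half of [k + 1] is the upper half of [k], and the two halves of [k] add up to [k]. *)
apply: (@recursive_rec1 half (fun k c => k - c)) => [|k].
  by apply: recursive_sub; exact: recursive_nth.
by rewrite /= uphalf_half -[X in X - _](odd_double_half k) -addnn addnA addnK.
Qed.

Lemma recursive_iter n (f : nat -> nat) (F G : n.-tuple nat -> nat) :
  recursive (fun w : 1.-tuple nat => f (nth 0 w 0)) ->
  recursive F -> recursive G -> recursive (fun v => iter (F v) f (G v)).
Proof.
move=> f_rec; apply: (@recursive_comp2 _ (fun k x => iter k f x)).
apply: (@recursive_rec (fun k x => iter k f x) id (fun _ c _ => f c)) => //.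
- exact: recursive_nth.
- by apply: recursive_comp1 => //; exact: recursive_nth.
Qed.

(** * Arithmetic on codes of sequences *)

Lemma iter_half k n m : k <= n -> iter k half (2 ^ n * m) = 2 ^ (n - k) * m.
Proof.
elim: k => [|k IHk] ltkn; first by rewrite subn0.
rewrite iterS IHk 1?ltnW // -(subnSK ltkn) expnS -mulnA mul2n.
by rewrite -{1}[_ * m]half_double doubleK half_double.
Qed.

(* The head of a nonempty coded sequence is the exponent of [2] in its code,  *)
(* found by halving as long as the result is even.                            *)
Fixpoint code_head_upto (k c : nat) : nat :=
  if k is k'.+1 then
    let j := code_head_upto k' c in j + (1 - odd (iter j half c))
  else 0.

Definition code_head (c : nat) : nat := code_head_upto c c.

(** Halving away the power of 2 leaves an odd number [2m + 1], where [m] codes the tail; one more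
    halving yields [m]. *)
Definition code_behead (c : nat) : nat := iter (code_head c).+1 half c.

Lemma code_headE x s : code_head (CodeSeq.code (x :: s)) = x.
Proof.
rewrite /code_head /=; set c := 2 ^ x * _.
have head_upto k : code_head_upto k c = minn k x.
  elim: k => [|k /= ->]; first by rewrite min0n.
  rewrite iter_half ?geq_minr //.
  case: (ltnP k x) => [ltkx|lexk].
    rewrite (minn_idPl ltkx) -(subnSK ltkx) expnS.
    by rewrite -mulnA mul2n odd_double addn1.
  rewrite (minn_idPr (leqW lexk)) subnn mul1n oddS.
  by rewrite odd_double addn0.
(* The search bound [c] suffices: every entry of a sequence is smaller than its code. *)
have:= CodeSeq.ltn_code (x :: s); rewrite head_upto /= => /andP[/ltnW lexc _].
exact/minn_idPr.
Qed.

Lemma code_beheadE s : code_behead (CodeSeq.code s) = CodeSeq.code (behead s).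
Proof.
case: s => [//|x s]; rewrite /code_behead code_headE iterS /=.
by rewrite iter_half // subnn mul1n /= uphalf_double.
Qed.

Lemma recursive_code_head n (F : n.-tuple nat -> nat) :
  recursive F -> recursive (fun v => code_head (F v)).
Proof.
apply: recursive_comp1.
apply: (@recursive_comp2 _ code_head_upto); [|exact: recursive_nth..].
apply: (@recursive_rec code_head_upto (fun=> 0)
  (fun _ j c => j + (1 - odd (iter j half c)))) => //.
  exact: recursive_const.
apply: recursive_add; first exact: recursive_nth.
apply: recursive_sub; first exact: recursive_const.
apply: recursive_odd; apply: recursive_iter; [|exact: recursive_nth..].
exact/recursive_half/recursive_nth.
Qed.

Lemma recursive_code_behead n (F : n.-tuple nat -> nat) :
  recursive F -> recursive (fun v => code_behead (F v)).
Proof.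
move=> F_rec; apply: recursive_iter => //.
  exact/recursive_half/recursive_nth.
exact/recursive_succ/recursive_code_head.
Qed.

Definition code_nth (i c : nat) : nat := code_head (iter i code_behead c).

Lemma iter_code_behead i s :
  iter i code_behead (CodeSeq.code s) = CodeSeq.code (drop i s).
Proof.
elim: i => [|i IHi]; first by rewrite drop0.
by rewrite iterS IHi code_beheadE -drop1 drop_drop add1n.
Qed.

Lemma code_nthE i s : code_nth i (CodeSeq.code s) = nth 0 s i.
Proof.
rewrite /code_nth iter_code_behead; have [leszi|ltisz] := leqP (size s) i.
  (* The empty sequence has code 0, whose head is 0, the default value of [nth]. *)
  by rewrite drop_oversize ?nth_default.
by rewrite (drop_nth 0 ltisz) code_headE.
Qed.

Lemma recursive_code_nth n i (F : n.-tuple nat -> nat) :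
  recursive F -> recursive (fun v => code_nth i (F v)).
Proof.
move=> F_rec; apply: recursive_code_head.
by elim: i => // i IHi; apply: recursive_code_behead.
Qed.

Lemma recursive_code_cons n (F G : n.-tuple nat -> nat) :
  recursive F -> recursive G -> recursive (fun v => 2 ^ F v * (G v).*2.+1).
Proof.
move=> F_rec G_rec; apply: recursive_mul; first exact: recursive_exp2.
apply: recursive_succ; apply: (eq_recursive (fun v => addnn (G v))).
exact: recursive_add.
Qed.

Lemma recursive_code2 n (F G : n.-tuple nat -> nat) :
  recursive F -> recursive G ->
  recursive (fun v => CodeSeq.code [:: F v; G v]).
Proof.
move=> F_rec G_rec; do 2![apply: recursive_code_cons => //].
exact: recursive_const.
Qed.

Definition mapi (T U : Type) (f : nat -> T -> U) (s : seq T) : seq U :=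
  [seq f p.1 p.2 | p <- zip (iota 0 (size s)) s].

(* The image of a sequence is built from its end, to avoid reversing it; the  *)
(* code of a sequence bounds its size.                                        *)
Fixpoint code_mapi_drop (f : nat -> nat -> nat) (k c : nat) : nat :=
  if k is k'.+1 then
    let j := c - k in
    let d := iter j code_behead c in
    (1 - (1 - d)) *
      (2 ^ f j (code_head d) * (code_mapi_drop f k' c).*2.+1)
  else 0.

Definition code_mapi (f : nat -> nat -> nat) (c : nat) : nat :=
  code_mapi_drop f c c.

Lemma size_code s : size s <= CodeSeq.code s.
Proof.
elim: s => //= x s IHs; rewrite -[_.+1]mul1n leq_mul ?expn_gt0 //.
by rewrite ltnS -addnn (leq_trans IHs) ?leq_addr.
Qed.

(** Invariant: after [k] rounds the value codes the image of the suffix starting at position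
    [c - k]. Since [c] bounds the size, the early rounds lie past the end and give 0, the code of
    the empty sequence. *)
Lemma code_mapiE f s : code_mapi f (CodeSeq.code s) = CodeSeq.code (mapi f s).
Proof.
pose l := zip (iota 0 (size s)) s.
have size_l : size l = size s by rewrite size_zip size_iota minnn.
have size_s := size_code s; set c := CodeSeq.code s in size_s *.
suffices map_drop k : k <= c -> code_mapi_drop f k c =
    CodeSeq.code [seq f p.1 p.2 | p <- drop (c - k) l].
  by rewrite /code_mapi map_drop // subnn drop0.
elim: k => [|k IHk] ltkc; first by rewrite subn0 drop_oversize ?size_l.
rewrite /= IHk 1?ltnW // -(subnSK ltkc); set j := c - k.+1.
have -> : iter j code_behead c = CodeSeq.code (drop j s) by apply: iter_code_behead.
have [lejs|ltjs] := leqP (size s) j; first by rewrite !drop_oversize ?size_l ?leqW.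
rewrite (drop_nth 0 ltjs) code_headE [RHS](_ : _ = 2 ^ f j (nth 0 s j) *
  (CodeSeq.code [seq f p.1 p.2 | p <- drop j.+1 l]).*2.+1); last first.
  rewrite (drop_nth (0, 0)) ?size_l //= nth_zip ?size_iota //=.
  by rewrite nth_iota.
(* The factor [1 - (1 - d)] is 1 for [d] positive and 0 otherwise; here the suffix is nonempty, so
   its code [d] is positive. *)
rewrite -[RHS]mul1n; congr (_ * _).
suffices: 0 < CodeSeq.code (nth 0 s j :: drop j.+1 s) by case: (CodeSeq.code _).
by rewrite /= muln_gt0 expn_gt0.
Qed.

Lemma recursive_code_mapi n (f : nat -> nat -> nat) (F : n.-tuple nat -> nat) :
  recursive (fun w : 2.-tuple nat => f (nth 0 w 0) (nth 0 w 1)) ->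
  recursive F -> recursive (fun v => code_mapi f (F v)).
Proof.
move=> f_rec; apply: recursive_comp1.
apply: (@recursive_comp2 _ (code_mapi_drop f)); [|exact: recursive_nth..].
apply: (@recursive_rec (code_mapi_drop f) (fun=> 0) (fun k r c =>
  let j := c - k.+1 in let d := iter j code_behead c in
  (1 - (1 - d)) * (2 ^ f j (code_head d) * r.*2.+1))) => //.
  exact: recursive_const.
have j_rec : recursive (fun w : 3.-tuple nat => nth 0 w 2 - (nth 0 w 0).+1).
  apply: recursive_sub; first exact: recursive_nth.
  exact/recursive_succ/recursive_nth.
have d_rec : recursive (fun w : 3.-tuple nat =>
    iter (nth 0 w 2 - (nth 0 w 0).+1) code_behead (nth 0 w 2)).
  apply: recursive_iter => //; last exact: recursive_nth.
  exact/recursive_code_behead/recursive_nth.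
apply: recursive_mul.
  by do 2!apply: (recursive_sub (recursive_const _ _)).
apply: recursive_code_cons; last exact: recursive_nth.
exact: recursive_comp2 f_rec j_rec (recursive_code_head d_rec).
Qed.

(** Transfers an entrywise translation to codes without decoding any entry. *)
Lemma pickle_mapi (T U : countType) (f : nat -> T -> U)
    (g : nat -> nat -> nat) (s : seq T) :
  (forall i x, choice.pickle (f i x) = g i (choice.pickle x)) ->
  choice.pickle (mapi f s) = code_mapi g (choice.pickle s).
Proof.
move=> fg; rewrite [choice.pickle s]/(CodeSeq.code _) code_mapiE.
congr CodeSeq.code; rewrite /mapi size_map.
elim: s 0 => //= x s IHs i.
by rewrite fg IHs.
Qed.

Lemma mapi_map (T U : Type) (f : T -> U) s : mapi (fun=> f) s = map f s.
Proof. by rewrite /mapi; elim: s 0 => //= x s IHs i; rewrite IHs. Qed.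

(** * Homogeneous encoding of vectors by polynomials *)

Local Open Scope ring_scope.

Section MalgMap.
Variables (K : nzRingType) (S T : choiceType) (g : S -> T).
Implicit Types v : {malg K[S]}.

Lemma malg_mapEw v (D : {fset S}) : (msupp v `<=` D)%fset ->
  malg_map g v = \sum_(s <- D) << v@_s *g g s >>.
Proof.
move=> le; rewrite [LHS](big_fset_incl _ le) //= => s _ /mcoeff_outdom ->.
by rewrite monalgU0.
Qed.

Lemma malg_map_is_linear : linear (malg_map g : {malg K[S]} -> {malg K[T]}).
Proof.
move=> c u v; pose D := (msupp u `|` msupp v)%fset.
have leD : (msupp (c *: u + v) `<=` D)%fset.
  apply: fsubset_trans (msuppD_le _ _) _.
  exact: fsetSU (msuppZ_le _ _).
rewrite (malg_mapEw leD) (malg_mapEw (fsubsetUl _ _ : _ `<=` D)%fset).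
rewrite (malg_mapEw (fsubsetUr _ _ : _ `<=` D)%fset) scaler_sumr -big_split.
apply: eq_bigr => s _ /=; apply/malgP => t.
by rewrite !(mcoeffD, mcoeffZ, mcoeffU) mulrnDl mulrnAr.
Qed.

HB.instance Definition _ :=
  GRing.isLinear.Build K {malg K[S]} {malg K[T]} *:%R (malg_map g)
    malg_map_is_linear.

Lemma malg_mapU c s : malg_map g << c *g s >> = << c *g g s >> :> {malg K[T]}.
Proof. by rewrite (malg_mapEw msuppU_le) big_seq_fset1 mcoeffUU. Qed.

Lemma malg_map_vec_of (s : seq (K * S)) :
  malg_map g (\sum_(p <- s) << p.1 *g p.2 >>) =
  \sum_(p <- s) << p.1 *g g p.2 >>.
Proof. by rewrite linear_sum; apply: eq_bigr => p _; exact: malg_mapU. Qed.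

Lemma mcoeff_malg_map v s : injective g -> (malg_map g v)@_(g s) = v@_s.
Proof.
move=> inj_g; rewrite raddf_sum [in RHS](monalgE v) raddf_sum /=.
by apply: eq_bigr => t _; rewrite !mcoeffU (inj_eq inj_g).
Qed.

End MalgMap.

Lemma malg_map_comp (K : nzRingType) (S T U : choiceType) (f : T -> U)
    (g : S -> T) (h : S -> U) (v : {malg K[S]}) :
  (forall s, f (g s) = h s) -> malg_map f (malg_map g v) = malg_map h v.
Proof.
move=> fg; rewrite {2}/malg_map linear_sum.
by apply: eq_bigr => s _ /=; rewrite malg_mapU fg.
Qed.

(* All the monomials of [malg_map E v] having the same degree, only the       *)
(* constant term of [h] contributes in that degree.                           *)
Lemma mcoeff_mul_homog (K : fieldType) (A S : choiceType)
    (E : S -> {cmonom A}) N (h : polyring K A) (v : {malg K[S]}) t :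
  injective E -> (forall s, mdeg (E s) = N) ->
  (h * malg_map E v)@_(E t) = h@_(mone : {cmonom A}) * v@_t.
Proof.
move=> inj_E degE; rewrite /malg_map mulr_sumr raddf_sum [in RHS](monalgE v).
rewrite raddf_sum mulr_sumr; apply: eq_bigr => s _ /=; rewrite malgM_def fgmulgU.
rewrite [in RHS](monalgE h) !raddf_sum mulr_suml; apply: eq_bigr => m _ /=.
rewrite !mcoeffU mulrnAl mulrnAr -mulrnA mulnb; congr (_ *+ nat_of_bool _).
apply/eqP/andP => [|[/eqP<- /eqP->]]; last by rewrite mul1m.
move=> mE; have m1 : m = mone.
  apply: mdeg_eq0I; apply/eqP; rewrite -(eqn_add2r (mdeg (E s))) -mdegM mE.
  by rewrite !degE.
by rewrite m1 eqxx; move: mE; rewrite m1 mul1m => /inj_E ->.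
Qed.

(** * Monomials as lists of powers, and the binary encoding of positions *)

Section Monomials.
Variable A : choiceType.
Implicit Types (l : seq (A * nat)) (m : {cmonom A}) (s : seq A).

Lemma expcmnE m n a : expcmn m n a = (n * m a)%N.
Proof.
case: n => [|n]; first by rewrite cm1.
rewrite /expcmn iteropS; elim: n => [|n IHn] /=; first by rewrite mul1n.
by rewrite cmM IHn -mulSn.
Qed.

Lemma monom_ofE l a : monom_of l a = (\sum_(p <- l) p.2 * (p.1 == a))%N.
Proof.
rewrite /monom_of; elim: l => [|p l IHl]; first by rewrite !big_nil cm1.
by rewrite !big_cons cmM IHl expcmnE cmU.
Qed.

Lemma mdeg_monom_of l : mdeg (monom_of l) = (\sum_(p <- l) p.2)%N.
Proof.
rewrite mdeg_prod; apply: eq_bigr => -[a n] _ /=.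
rewrite (mdegEw (_ : _ `<=` [fset a])%fset) ?big_seq_fset1 ?expcmnE ?cmUU ?muln1 //.
apply/fsubsetP => b; rewrite -cmE_neq0 expcmnE cmU in_fset1.
by case: (eqVneq a b) => // _; rewrite muln0.
Qed.

Lemma rename_monomE (f : A -> A) m (D : {fset A}) b :
  (finsupp m `<=` D)%fset ->
  rename_monom f m b = (\sum_(a <- D) m a * (f a == b))%N.
Proof.
move=> le; rewrite monom_ofE big_map (big_fset_incl _ le) //= => a _.
by rewrite -cmE_neq0 negbK => /eqP ->.
Qed.

(** Each listed power contributes its exponent to the image of its variable; on both sides,
    variables merged by [f] have their exponents added. *)
Lemma rename_monom_of (f : A -> A) l :
  rename_monom f (monom_of l) = monom_of [seq (f p.1, p.2) | p <- l].
Proof.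
(* [D] collects all listed variables, including those with exponent 0, so it contains the
   support. *)
apply/eqP/cmP => b; pose D := [fset p.1 | p in l]%fset.
rewrite monom_ofE big_map /= (@rename_monomE _ _ D); last first.
  apply/fsubsetP => a; rewrite -cmE_neq0 monom_ofE; apply: contraR => aD.
  rewrite big_seq big1 // => p pl; case: eqP aD => [<-|_ _]; last by rewrite muln0.
  by rewrite in_imfset.
under eq_bigr do rewrite monom_ofE big_distrl /=.
rewrite exchange_big /= [LHS]big_seq [RHS]big_seq; apply: eq_bigr => p pl.
rewrite (big_fsetD1 p.1) ?in_imfset //= eqxx muln1 big1_fset ?addn0 // => a.
by rewrite in_fsetD1 eq_sym => /andP[/negPf-> _] _; rewrite muln0.
Qed.

Definition powers s : seq (A * nat) := mapi (fun i a => (a, 2 ^ i)%N) s.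

Lemma map_powers (f : A -> A) s :
  [seq (f p.1, p.2) | p <- powers s] = powers (map f s).
Proof.
rewrite /powers /mapi size_map.
by elim: s (iota _ _) => [|a s IHs] [|i l] //=; rewrite IHs.
Qed.

(** Moving one place to the right doubles an exponent. Applied with the exponent itself for degrees,
    and with the exponent of one fixed variable for injectivity. *)
Lemma powers_rec (F : A * nat -> nat) a s :
  (forall b n, F (b, 2 * n) = 2 * F (b, n))%N ->
  (\sum_(p <- powers (a :: s)) F p =
   F (a, 1) + 2 * \sum_(p <- powers s) F p)%N.
Proof.
move=> F2; rewrite /powers /mapi /= big_cons; congr (_ + _)%N.
rewrite big_distrr /= -[1%N]addn0 iotaDl; elim: s (iota _ _) => [|b s IHs] [|i l].
- by rewrite !big_nil.
- by rewrite !big_nil.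
- by rewrite !big_nil.
by rewrite /= !big_cons IHs add1n expnS F2.
Qed.

Lemma mdeg_powers s1 s2 : size s1 = size s2 ->
  mdeg (monom_of (powers s1)) = mdeg (monom_of (powers s2)).
Proof.
rewrite !mdeg_monom_of; elim: s1 s2 => [|a s1 IHs] [|b s2] //= [/IHs eq_deg].
by rewrite !powers_rec // eq_deg.
Qed.

(** The parity of the exponent of [a] tells whether [a] stands at the head. Once the heads agree,
    cancelling this bit and halving gives the same equations for the tails. *)
Lemma monom_of_powers_inj s1 s2 : size s1 = size s2 ->
  monom_of (powers s1) = monom_of (powers s2) -> s1 = s2.
Proof.
move=> eqsz /eqP/cmP eq12.
have {}eq12 a : (\sum_(p <- powers s1) p.2 * (p.1 == a) =
    \sum_(p <- powers s2) p.2 * (p.1 == a))%N by rewrite -!monom_ofE.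
elim: s1 s2 eqsz eq12 => [|a1 s1 IHs] [|a2 s2] //= [/IHs eqs] eq12.
have rec a b s : (\sum_(p <- powers (b :: s)) p.2 * (p.1 == a) =
    (b == a) + 2 * \sum_(p <- powers s) p.2 * (p.1 == a))%N.
  by rewrite powers_rec ?mul1n // => c n; rewrite mulnA.
have eq_a : a2 = a1.
  have /(congr1 odd) := eq12 a1; rewrite !rec eqxx !mul2n !oddD !odd_double.
  by case: eqP.
rewrite eq_a eqs // => a; have := eq12 a; rewrite !rec eq_a.
by move/addnI/eqP; rewrite eqn_mul2l => /eqP.
Qed.

End Monomials.

(** * The reduction *)

Definition term_powers (K : Type) (A : choiceType) d (p : K * d.-tuple A) :
  K * seq (A * nat) := (p.1, powers p.2).

Definition ideal_input (K : countFieldType) (A : relstruct) (x : lin_input K A) :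
    input (Ideal_memb K A) :=
  ([seq term_powers p | p <- (tagged x).1],
   [seq [seq term_powers p | p <- q.2] | q <- (tagged x).2]).

Definition term_code (c : nat) : nat :=
  CodeSeq.code [:: code_nth 0 c;
    code_mapi (fun i a => CodeSeq.code [:: a; 2 ^ i])%N (code_nth 1 c)].

Definition terms_code : nat -> nat := code_mapi (fun=> term_code).

(** The inner [code_nth 1 c] steps past the dimensions to the pair of [b] and [B]; [code_nth 1 q]
    takes the vector attached to a listed tuple. *)
Definition input_code (c : nat) : nat :=
  CodeSeq.code [:: terms_code (code_nth 0 (code_nth 1 c));
    code_mapi (fun _ q => terms_code (code_nth 1 q))
      (code_nth 1 (code_nth 1 c))].

Lemma recursive_terms_code n (F : n.-tuple nat -> nat) :
  recursive F -> recursive (fun v => terms_code (F v)).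
Proof.
apply: recursive_code_mapi; apply: recursive_code2.
  exact/recursive_code_nth/recursive_nth.
apply: recursive_code_mapi; last exact/recursive_code_nth/recursive_nth.
by apply: recursive_code2; [|apply: recursive_exp2]; exact: recursive_nth.
Qed.

Lemma recursive_input_code :
  recursive (fun v : 1.-tuple nat => input_code (nth 0%N v 0)).
Proof.
have c_rec : recursive (fun v : 1.-tuple nat => code_nth 1 (nth 0%N v 0)).
  exact/recursive_code_nth/recursive_nth.
apply: recursive_code2; first exact/recursive_terms_code/recursive_code_nth.
apply: recursive_code_mapi; last exact: recursive_code_nth.
exact/recursive_terms_code/recursive_code_nth/recursive_nth.
Qed.

Lemma pickle_pair (T U : countType) (p : T * U) :
  choice.pickle p = CodeSeq.code [:: choice.pickle p.1; choice.pickle p.2].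
Proof. by []. Qed.

Lemma code_nth0_pickle (T U : countType) (p : T * U) :
  code_nth 0 (choice.pickle p) = choice.pickle p.1.
Proof. by rewrite pickle_pair code_nthE. Qed.

Lemma code_nth1_pickle (T U : countType) (p : T * U) :
  code_nth 1 (choice.pickle p) = choice.pickle p.2.
Proof. by rewrite pickle_pair code_nthE. Qed.

Lemma code_nth1_pickle_tagged (I : countType) (T : I -> countType)
    (x : {i : I & T i}) :
  code_nth 1 (choice.pickle x) = choice.pickle (tagged x).
Proof. exact: (code_nthE 1 [:: _; _]). Qed.

Lemma pickle_terms (K A : countType) d (s : seq (K * d.-tuple A)) :
  choice.pickle [seq term_powers p | p <- s] = terms_code (choice.pickle s).
Proof.
rewrite -mapi_map; apply: pickle_mapi => _ p.
rewrite [LHS]pickle_pair /term_code code_nth0_pickle code_nth1_pickle.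
by congr (CodeSeq.code [:: _; _]); apply: pickle_mapi.
Qed.

Lemma pickle_terms_family (K A T : countType) d
    (B : seq (T * seq (K * d.-tuple A))) :
  choice.pickle [seq [seq term_powers p | p <- q.2] | q <- B] =
  code_mapi (fun _ q => terms_code (code_nth 1 q)) (choice.pickle B).
Proof.
rewrite -mapi_map; apply: pickle_mapi => _ q.
by rewrite pickle_terms code_nth1_pickle.
Qed.

Lemma pickle_ideal_input (K : countFieldType) (A : relstruct)
    (x : lin_input K A) :
  choice.pickle (ideal_input x) = input_code (choice.pickle x).
Proof.
rewrite [LHS]pickle_pair /input_code code_nth1_pickle_tagged.
case: x => -[d n] [b B]; rewrite /ideal_input.
rewrite code_nth0_pickle code_nth1_pickle.
congr (CodeSeq.code [:: _; _]); first exact: pickle_terms.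
exact: pickle_terms_family.
Qed.

(** * Linear combinations versus ideal membership *)

Section Correctness.
Variables (K : countFieldType) (A : relstruct) (d n : nat).

Definition tuple_monom (t : d.-tuple A) : {cmonom A} := monom_of (powers t).

Definition lin_poly : Lin K A d -> polyring K A := malg_map tuple_monom.

Lemma poly_of_terms (s : seq (K * d.-tuple A)) :
  poly_of [seq term_powers p | p <- s] = lin_poly (vec_of s).
Proof. by rewrite /lin_poly /vec_of malg_map_vec_of /poly_of big_map. Qed.

Lemma poly_act_lin_poly (iota : A -> A) (v : Lin K A d) :
  poly_act iota (lin_poly v) = lin_poly (lin_act iota v).
Proof.
rewrite [RHS](malg_map_comp (h := tuple_monom \o map_tuple iota)) //.
apply: malg_map_comp => t.
by rewrite rename_monom_of map_powers.
Qed.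

Lemma tuple_monom_inj : injective tuple_monom.
Proof.
move=> t1 t2 eq12; apply: val_inj.
by apply: monom_of_powers_inj eq12; rewrite !size_tuple.
Qed.

Lemma mcoeff_mul_lin_poly (h : polyring K A) (v : Lin K A d) t :
  (h * lin_poly v)@_(tuple_monom t) = h@_(mone : {cmonom A}) * v@_t.
Proof.
apply: (@mcoeff_mul_homog _ _ _ _ (mdeg (tuple_monom t))) => [|s].
  exact: tuple_monom_inj.
by apply: mdeg_powers; rewrite !size_tuple.
Qed.

Lemma lin_combination_ideal_memb (b : seq (K * d.-tuple A))
    (B : seq (n.-tuple A * seq (K * d.-tuple A))) (M : n.-tuple A -> Lin K A d) :
  represents B M ->
  lin_combination (vec_of b) M <->
  ideal_memb (poly_of [seq term_powers p | p <- b])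
    [seq poly_of g | g <- [seq [seq term_powers p | p <- q.2] | q <- B]].
Proof.
case=> equivM BM coverB; rewrite poly_of_terms -map_comp.
set B' := map _ B.
have B'E q : q \in B -> poly_of [seq term_powers p | p <- q.2] = lin_poly (M q.1).
  by move=> qB; rewrite poly_of_terms BM.
have B'P q : q \in B -> lin_poly (M q.1) \in B'.
  by move=> qB; rewrite -B'E //; apply: (map_f _ qB).
split=> [[k [r [t def_b]]]|[k [h [g [iota [gB' def_b]]]]]].
  (* Every index [t i] is the image of a listed tuple, so by equivariance [M (t i)] is the image of
     a listed vector; the scalars become constant multipliers. *)
  have /fin_all_exists[iq iqP] (i : 'I_k) : exists iq : (A -> A) * _,
      [/\ embedding iq.1, iq.2 \in B & t i = map_tuple iq.1 iq.2.1].
    by have [iota [q iotaP]] := coverB (t i); exists (iota, q).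
  exists k, (fun i => (r i)%:MP), (fun i => lin_poly (M (iq i).2.1)).
  exists (fun i => (iq i).1); split=> [i|].
    by have [iP qB _] := iqP i; split=> //; exact: B'P.
  rewrite def_b /lin_poly linear_sum; apply: eq_bigr => i _.
  have [iP _ tE] := iqP i.
  by rewrite mul_malgC poly_act_lin_poly equivM // -tE linearZ.
have /fin_all_exists[t tP] (i : 'I_k) : exists t : n.-tuple A,
    poly_act (iota i) (g i) = lin_poly (M t).
  have [/mapP[q qB ->] iP] := gB' i; exists (map_tuple (iota i) q.1).
  by rewrite [X in poly_act _ X](B'E q qB) poly_act_lin_poly equivM.
(* The scalars are the constant terms of the multipliers; equality is checked by comparing
   coefficients at [tuple_monom s]. *)
exists k, (fun i => (h i)@_(mone : {cmonom A})), t; apply/malgP => s.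
rewrite -(mcoeff_malg_map _ _ tuple_monom_inj) [malg_map _ _]def_b !raddf_sum.
by apply: eq_bigr => i _ /=; rewrite tP mcoeff_mul_lin_poly mcoeffZ.
Qed.

End Correctness.

Theorem theorem9p1 (K : countFieldType) (A : relstruct) :
  computable_field K ->
  equality_definable A ->
  omega_well_structured A ->
  reduces (Lin_solv K A) (Ideal_memb K A).
Proof.
move=> _ _ _; have [p pP] := recursive_input_code; exists p => x [M BM].
exists (ideal_input x); split=> //.
  by rewrite /maps_to pickle_ideal_input; exact: pP.
(* The equivalence is stated for any represented family: a positive answer brings its own [N], while
   the converse uses the [M] given by validity. *)
have memb N (BN : represents (tagged x).2 N) :=
  lin_combination_ideal_memb (tagged x).1 BN.
split=> [[N [BN /(memb _ BN)]] // | /(memb _ BM) Mb].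
by exists M.
Qed.
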